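(* Let $X$ be a compact Hausdorff space and let $\varphi_{0,\infty}=\{\varphi_j\}_{j=0}^\infty$ be a sequence of lower semicontinuous multivalued maps $\varphi_j:X\multimap X$, $j\in\mathbb{N}\cup\{0\}$. Then $$h_L(\varphi_{0,\infty})=h_{\mathrm{CMM}}^{\mathrm{span}}(\varphi_{0,\infty})\le h_{\mathrm{CMM}}^{\mathrm{sep}}(\varphi_{0,\infty})\le h_U(\varphi_{0,\infty})\le h_{\mathrm{KTRT}}(\varphi_{0,\infty}).$$
   Context: Multivalued maps $\varphi:X\multimap X$ assign to each point a nonempty subset of $X$. $\varphi$ is lower semicontinuous (l.s.c.) if $\varphi_+^{-1}(B)=\{x\in X:\varphi(x)\cap B\neq\emptyset\}$ is open for every open $B\subset X$. $\mathbb{N}=\{1,2,\dots\}$. Uniformities. A uniformity on a nonempty set $X$ is a family $\mathcal{U}$ of pseudometrics on $X$ such that: (U1) $p_0,p_1\in\mathcal{U}$ implies $\max\{p_0,p_1\}\in\mathcal{U}$; (U2) if $p$ is a pseudometric on $X$ such that for every $\varepsilon>0$ there are $q\in\mathcal{U}$, $\delta>0$ with $q(x,y)<\delta\Rightarrow p(x,y)<\varepsilon$ for all $x,y\in X$, then $p\in\mathcal{U}$; (U3) for $x\ne y$ there is $p\in\mathcal{U}$ with $p(x,y)>0$. The balls $B_p(x,r)=\{y: p(x,y)<r\}$, $p\in\mathcal{U}$, $x\in X$, $r>0$, form a base of a Hausdorff topology. A compact Hausdorff space $X$ carries a unique uniformity $\mathcal{U}$ inducing its topology; this is the $\mathcal{U}$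 used below. For a function $q:Z\times Z\to[0,\infty)$ and $\varepsilon>0$, $S\subset Z$ is $(q,\varepsilon)$-separated if $q(x,y)>\varepsilon$ for all distinct $x,y\in S$; $R\subset Z$ is $(q,\varepsilon)$-spanning in $Z$ if for every $y\in Z$ there is $x\in R$ with $q(x,y)\le\varepsilon$. Orbits. $\mathrm{Orb}_1(\varphi_{0,\infty})=X$, $\mathrm{Orb}_n(\varphi_{0,\infty})=\{(x_0,\dots,x_{n-1})\in X^n: x_{i+1}\in\varphi_i(x_i),\ i=0,\dots,n-2\}$ for $n\ge2$, and $\mathrm{Orb}_n(\varphi_{0,\infty},x)$ is the set of those with $x_0=x$. $\pi_1$ denotes the projection $(x_0,\dots,x_{n-1})\mapsto x_0$. $h_{\mathrm{KTRT}}$: for $p\in\mathcal{U}$ let $p_n(\bar x,\bar y)=\max_{0\le i\le n-1}p(\bar x_i,\bar y_i)$ on $X^n$. Let $s_{\mathrm{KTRT}}(\varphi_{0,\infty},p,\varepsilon,n)$ be the largest cardinality of a $(p_n,\varepsilon)$-separated subset of $\mathrm{Orb}_n(\varphi_{0,\infty})$. Then $h_{\mathrm{KTRT}}(\varphi_{0,\infty})=\sup_{p\in\mathcal{U},\varepsilon>0}\limsup_{n\to\infty}\frac1n\log s_{\mathrm{KTRT}}(\varphi_{0,\infty},p,\varepsilon,n)$. (The same value is obtained with the smallest cardinality of a subset of $\mathrm{Orb}_n(\varphi_{0,\infty})$ that is $(p_n,\varepsilon)$-spanning in $\mathrm{Orb}_n(\varphi_{0,\infty})$.) $h_{\mathrm{CMM}}$: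 for $x,y\in X$ let $p_n^{\mathrm{CMM}}(x,y)=\inf\{\max_{0\le i\le n-1}p(\bar x_i,\bar y_i):\bar x\in\mathrm{Orb}_n(\varphi_{0,\infty},x),\bar y\in\mathrm{Orb}_n(\varphi_{0,\infty},y)\}$. Let $s_{\mathrm{CMM}}(\varphi_{0,\infty},p,\varepsilon,n)$ be the largest cardinality of a $(p_n^{\mathrm{CMM}},\varepsilon)$-separated subset of $X$ and $r_{\mathrm{CMM}}(\varphi_{0,\infty},p,\varepsilon,n)$ the smallest cardinality of a $(p_n^{\mathrm{CMM}},\varepsilon)$-spanning set in $X$. Then $h_{\mathrm{CMM}}^{\mathrm{sep}}(\varphi_{0,\infty})=\sup_{p\in\mathcal{U},\varepsilon>0}\limsup_{n}\frac1n\log s_{\mathrm{CMM}}$ and $h_{\mathrm{CMM}}^{\mathrm{span}}(\varphi_{0,\infty})=\sup_{p\in\mathcal{U},\varepsilon>0}\limsup_{n}\frac1n\log r_{\mathrm{CMM}}$. Covering entropies. For a cover $\mathcal{C}$ of $X$, $N(\mathcal{C})$ is the minimal cardinality of a subcover of $\mathcal{C}$. For $A_0,\dots,A_{n-1}\subset X$ let $\mathcal{F}(\varphi_{0,\infty};A_0,\dots,A_{n-1})=\pi_1(\mathrm{Orb}_n(\varphi_{0,\infty})\cap(A_0\times\dots\times A_{n-1}))$. For an open cover $\mathcal{A}$ of $X$ let $\mathcal{F}(\varphi_{0,\infty};\mathcal{A}^n)=\{\mathcal{F}(\varphi_{0,\infty};A_0,\dots,A_{n-1}):A_0,\dots,A_{n-1}\in\mathcal{A}\}$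 (an open cover of $X$). The upper covering entropy is $h_U(\varphi_{0,\infty})=\sup_{\mathcal{A}}\limsup_{n\to\infty}\frac1n\log N(\mathcal{F}(\varphi_{0,\infty};\mathcal{A}^n))$, supremum over open covers $\mathcal{A}$ of $X$. For $x\in X$ let $\mathcal{A}^n(\varphi_{0,\infty},x)=\pi_1\{\bar y\in\mathrm{Orb}_n(\varphi_{0,\infty}):\exists\bar x\in\mathrm{Orb}_n(\varphi_{0,\infty},x)\ \exists A_0,\dots,A_{n-1}\in\mathcal{A}\text{ with }\bar x_i,\bar y_i\in A_i,\ i=0,\dots,n-1\}$ and $\mathcal{A}^n(\varphi_{0,\infty})=\{\mathcal{A}^n(\varphi_{0,\infty},x):x\in X\}$ (an open cover of $X$). The lower covering entropy is $h_L(\varphi_{0,\infty})=\sup_{\mathcal{A}}\limsup_{n\to\infty}\frac1n\log N(\mathcal{A}^n(\varphi_{0,\infty}))$, supremum over open covers $\mathcal{A}$ of $X$. *)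

(* Defs.v *)
From HB Require Import structures.
From mathcomp Require Import all_boot all_order all_algebra.
From mathcomp Require Import all_classical all_reals all_analysis.
Set Implicit Arguments. Unset Strict Implicit. Unset Printing Implicit Defensive.
Import Order.TTheory GRing.Theory Num.Theory.
Local Open Scope classical_set_scope.
Local Open Scope ring_scope.

Record pseudometric (R : realType) (X : Type) (p : X -> X -> R) : Prop := {
  pseudometric_ge0 : forall x y, 0 <= p x y;
  pseudometric_refl : forall x, p x x = 0;
  pseudometric_sym : forall x y, p x y = p y x;
  pseudometric_triangle : forall x y z, p x z <= p x y + p y z }.

Definition pball (R : realType) (X : Type) (p : X -> X -> R) (x : X) (r : R) :
  set X := [set y | p x y < r].

Record uniformity (R : realType) (X : Type) (U : set (X -> X -> R)) : Prop := {
  uniformity_pseudometric : forall p, U p -> pseudometric p;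
  uniformity_max : forall p0 p1, U p0 -> U p1 ->
    U (fun x y => Num.max (p0 x y) (p1 x y));
  uniformity_saturated : forall p, pseudometric p ->
    (forall e : R, 0 < e -> exists q, exists d : R, [/\ U q, 0 < d &
       forall x y, q x y < d -> p x y < e]) ->
    U p;
  uniformity_separated : forall x y, x <> y -> exists2 p, U p & 0 < p x y }.

(* On a compact Hausdorff space exactly one uniformity satisfies this. *)
Definition induces_topology (R : realType) (X : topologicalType)
    (U : set (X -> X -> R)) : Prop :=
  basis [set B : set X | exists p x (r : R),
           [/\ U p, 0 < r & B = pball p x r]].

Definition multivalued (X : Type) (f : X -> set X) : Prop :=
  forall x, f x !=set0.

Definition lsc (X : topologicalType) (f : X -> set X) : Prop :=
  forall B : set X, open B -> open [set x | f x `&` B !=set0].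

Definition separated (R : realType) (Z : Type) (q : Z -> Z -> R) (e : R)
    (S : set Z) : Prop :=
  forall x y, S x -> S y -> x <> y -> e < q x y.

Definition spanning (R : realType) (Z : Type) (q : Z -> Z -> R) (e : R)
    (S : set Z) : Prop :=
  forall y, exists2 x, S x & q x y <= e.

(* Cardinalities are valued in \bar R ([counting] is +oo on infinite sets), so
   largest and smallest cardinalities are [ereal_sup] and [ereal_inf]. *)
Definition max_separated (R : realType) (Z : choiceType) (q : Z -> Z -> R)
    (D : set Z) (e : R) : \bar R :=
  ereal_sup [set @counting Z R S | S in
    [set S : set Z | S `<=` D /\ separated q e S]].

Definition min_spanning (R : realType) (Z : choiceType) (q : Z -> Z -> R)
    (e : R) : \bar R :=
  ereal_inf [set @counting Z R S | S in spanning q e].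

Definition is_cover (X : Type) (C : set (set X)) : Prop :=
  cover C id = [set: X].

Definition open_cover (X : topologicalType) (C : set (set X)) : Prop :=
  C `<=` open /\ is_cover C.

Definition min_subcover (R : realType) (X : Type) (C : set (set X)) : \bar R :=
  ereal_inf [set @counting (set X) R D | D in
    [set D : set (set X) | D `<=` C /\ is_cover D]].

(* Everything below is indexed by n : nat but concerns orbits of length n.+1,
   so that the first point of an orbit always exists; hence the shift here. *)
Definition growth (R : realType) (a : nat -> \bar R) : \bar R :=
  limn_esup (fun n => ((n.+1%:R)^-1)%:E * lne (a n))%E.

Section Orbits.
Context (X : Type) (phi : nat -> X -> set X).

Definition Orb (n : nat) : set ('I_n.+1 -> X) :=
  [set xs | forall i j : 'I_n.+1, val j = (val i).+1 -> phi i (xs i) (xs j)].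

Definition Orb_from (n : nat) (x : X) : set ('I_n.+1 -> X) :=
  [set xs | Orb xs /\ xs ord0 = x].

Definition pi1 (n : nat) (xs : 'I_n.+1 -> X) : X := xs ord0.

(* F(phi; A_0, ..., A_n) *)
Definition cell (n : nat) (A : 'I_n.+1 -> set X) : set X :=
  @pi1 n @` (@Orb n `&` [set xs | forall i, A i (xs i)]).

(* F(phi; C^{n+1}) *)
Definition upper_family (C : set (set X)) (n : nat) : set (set X) :=
  @cell n @` [set A | forall i, C (A i)].

(* C^{n+1}(phi, x) *)
Definition star (C : set (set X)) (n : nat) (x : X) : set X :=
  @pi1 n @` [set ys | Orb ys /\ exists2 xs, @Orb_from n x xs &
    exists A : 'I_n.+1 -> set X,
      forall i, [/\ C (A i), A i (xs i) & A i (ys i)]].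

(* C^{n+1}(phi) *)
Definition lower_family (C : set (set X)) (n : nat) : set (set X) :=
  range (star C n).

End Orbits.

(* [p] is nonnegative, so the default value 0 does not affect the maximum. *)
Definition orbit_dist (R : realType) (X : Type) (p : X -> X -> R) (n : nat)
    (xs ys : 'I_n.+1 -> X) : R :=
  \big[Num.max/0]_(i < n.+1) p (xs i) (ys i).

Definition cmm_dist (R : realType) (X : Type) (phi : nat -> X -> set X)
    (p : X -> X -> R) (n : nat) (x y : X) : R :=
  inf [set orbit_dist p xs ys |
         xs in @Orb_from X phi n x & ys in @Orb_from X phi n y].

Definition h_KTRT (R : realType) (X : topologicalType) (U : set (X -> X -> R))
    (phi : nat -> X -> set X) : \bar R :=
  ereal_sup [set growth (fun n =>
                   max_separated (@orbit_dist R X p n) (@Orb X phi n) e) |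
               p in U & e in [set e : R | 0 < e]].

Definition h_CMM_sep (R : realType) (X : topologicalType)
    (U : set (X -> X -> R)) (phi : nat -> X -> set X) : \bar R :=
  ereal_sup [set growth (fun n => max_separated (cmm_dist phi p n) [set: X] e) |
               p in U & e in [set e : R | 0 < e]].

Definition h_CMM_span (R : realType) (X : topologicalType)
    (U : set (X -> X -> R)) (phi : nat -> X -> set X) : \bar R :=
  ereal_sup [set growth (fun n => min_spanning (cmm_dist phi p n) e) |
               p in U & e in [set e : R | 0 < e]].

Definition h_U (R : realType) (X : topologicalType) (phi : nat -> X -> set X) :
    \bar R :=
  ereal_sup [set growth (fun n => min_subcover R (upper_family phi C n)) |
               C in @open_cover X].

Definition h_L (R : realType) (X : topologicalType) (phi : nat -> X -> set X) :
    \bar R :=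
  ereal_sup [set growth (fun n => min_subcover R (lower_family phi C n)) |
               C in @open_cover X].

(* Main.v *)
Require Import Defs.
From HB Require Import structures.
From mathcomp Require Import all_boot all_order all_algebra.
From mathcomp Require Import all_classical all_reals all_analysis.
Import Order.TTheory GRing.Theory Num.Theory.
Set Implicit Arguments.
Unset Strict Implicit.
Unset Printing Implicit Defensive.
Local Open Scope classical_set_scope.
Local Open Scope ring_scope.

(** All five entropies are suprema of growth rates, and growth rates are
monotone, so each inequality reduces to a comparison of cardinalities for a
fixed orbit length. Two dictionaries pass between the metric and the covering
side. From a pseudometric p and e > 0 to a cover: take the p-balls of radius
e / 2; two orbits that run through the same members of this cover are at orbit
distance at most e ([orbit_dist_pball]). From an open cover C to a
pseudometric: by compactness there are p and e > 0 such that every closed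
p-ball of radius e lies in some member of C ([lebesgue_number]).

- h_L <= h_CMM^span: for a Lebesgue pair (p, e) of C, the stars of the points
  of a spanning set at scale e / 2 cover X.
- h_CMM^span <= h_L: for the cover by balls of radius e / 2, centres of the
  stars of a subcover form a spanning set at scale e.
- h_CMM^span <= h_CMM^sep: a maximal separated set is spanning
  ([exists_separated_spanning]).
- h_CMM^sep <= h_U: for the cover by balls of radius e / 2, each cell contains
  at most one point of a separated set at scale e.
- h_U <= h_KTRT: for a Lebesgue pair (p, e) of C and a maximal separated set S
  of orbits, each orbit in S yields a cell of C that contains the initial
  points of all orbits at distance at most e from it; since S is spanning and
  every point starts an orbit, these cells cover X. *)

(** * Monotonicity of growth rates and of cardinalities *)

Lemma limn_esup_le (R : realType) (u v : nat -> \bar R) :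
  (forall n, u n <= v n)%E -> (limn_esup u <= limn_esup v)%E.
Proof.
move=> uv; rewrite !limn_esup_lim.
apply: lee_lim; [exact: is_cvg_esups|exact: is_cvg_esups|].
apply: nearW => n; apply: ge_ereal_sup => _ [k nk <-].
by apply: (le_trans (uv k)); apply: ereal_sup_ubound; exists k.
Qed.

Lemma lne_le (R : realType) (x y : \bar R) : (x <= y)%E -> (lne x <= lne y)%E.
Proof.
move=> xy; have [x0|x0] := leP x 0%E; first by rewrite le0_lneNy// leNye.
by rewrite lee_lne// in_itv/= leey andbT ltW// (lt_le_trans x0).
Qed.

Lemma growth_le (R : realType) (a b : nat -> \bar R) :
  (forall n, a n <= b n)%E -> (growth a <= growth b)%E.
Proof.
move=> ab; apply: limn_esup_le => n; apply: lee_wpmul2l; last exact: lne_le.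
by rewrite lee_fin invr_ge0.
Qed.

Lemma counting_le (R : realType) (S T : choiceType) (A : set S) (B : set T) :
  (A #<= B)%card -> (@counting S R A <= @counting T R B)%E.
Proof.
move=> AB; rewrite /counting; case: (asboolP (finite_set B)) => finB.
  rewrite asboolT ?lee_fin ?ler_nat; last exact: card_le_finite finB.
  case/finite_setP: (finB) => n; rewrite card_eq_le => /andP[Bn nB].
  apply: (@leq_trans n); last exact: leq_card_fset_set.
  by apply: geq_card_fset_set; exact: card_le_trans Bn.
by rewrite leey.
Qed.

(** * Maximal separated sets *)

(** By Zorn's lemma there is a maximal separated subset of D, and maximality
makes it spanning in D. Since no finiteness is needed, the sets may be
infinite, in which case the cardinality bounds drawn from them are trivial. *)
Lemma exists_separated_spanning (R : realType) (Z : Type) (q : Z -> Z -> R)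
    (D : set Z) (e : R) :
  (forall x, D x -> q x x <= e) -> (forall x y, q x y = q y x) ->
  exists S : set Z, [/\ S `<=` D, Defs.separated q e S &
    forall y, D y -> exists2 x, S x & q x y <= e].
Proof.
move=> q_diag q_sym.
pose P (S : set Z) := S `<=` D /\ Defs.separated q e S.
have [F FP Ftot|S [[SD Ssep] Smax]] := @Zorn_bigcup _ P.
  split=> [x [A /FP[AD _]]|x y [A FA Ax] [B FB By]]; first exact: AD.
  have [AB|BA] := Ftot _ _ FA FB.
    by apply: (FP _ FB).2 => //; exact: AB.
  by apply: (FP _ FA).2 => //; exact: BA.
exists S; split=> // y Dy; apply: contrapT => far_y.
have Sy x : S x -> e < q x y.
  by move=> Sx; rewrite ltNge; apply/negP => qxy; apply: far_y; exists x.
apply: (Smax (S `|` [set y])).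
  split; first exact: subsetUl.
  by move=> /(_ y (or_intror erefl)) /Sy; rewrite ltNge q_diag.
split=> [x [/SD//|->//]|x z [Sx|->] [Sz|->]] => [||+|//].
- exact: Ssep.
- by move=> _; exact: Sy.
- by rewrite q_sym => _; exact: Sy.
Qed.

(** * Orbit distances *)

Section OrbitDist.
Context (R : realType) (X : Type) (phi : nat -> X -> set X) (p : X -> X -> R).

Lemma orbit_dist_ge0 n (xs ys : 'I_n.+1 -> X) : 0 <= orbit_dist p xs ys.
Proof. by rewrite /orbit_dist; exact: bigmax_ge_id. Qed.

Lemma orbit_dist_le n (xs ys : 'I_n.+1 -> X) e : 0 <= e ->
  (forall i, p (xs i) (ys i) <= e) -> orbit_dist p xs ys <= e.
Proof. by move=> e0 pe; apply: bigmax_le. Qed.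

Lemma le_orbit_dist n (xs ys : 'I_n.+1 -> X) i :
  p (xs i) (ys i) <= orbit_dist p xs ys.
Proof. exact: (le_bigmax _ (fun j => p (xs j) (ys j))). Qed.

Lemma orbit_dist_sym n (xs ys : 'I_n.+1 -> X) : pseudometric p ->
  orbit_dist p xs ys = orbit_dist p ys xs.
Proof. by move=> pp; apply: eq_bigr => i _; rewrite (pseudometric_sym pp). Qed.

Lemma orbit_dist_refl n (xs : 'I_n.+1 -> X) : pseudometric p ->
  orbit_dist p xs xs = 0.
Proof.
move=> pp; apply/le_anti; rewrite orbit_dist_ge0 andbT.
by apply: orbit_dist_le => // i; rewrite (pseudometric_refl pp).
Qed.

Lemma Orb_from_nonempty n x : (forall j, multivalued (phi j)) ->
  @Orb_from X phi n x !=set0.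
Proof.
move=> phi0.
have /choice[f fP] : forall jx : nat * X, exists y, phi jx.1 jx.2 y.
  by move=> [j y]; exact: phi0.
pose fix o k := if k is j.+1 then f (j, o j) else x.
by exists (fun i => o i); split=> // i j /= ->; exact: (fP (_, _)).
Qed.

Lemma cmm_dist_le n x y (xs ys : 'I_n.+1 -> X) e :
  Orb_from phi x xs -> Orb_from phi y ys -> orbit_dist p xs ys <= e ->
  cmm_dist phi p n x y <= e.
Proof.
move=> xxs yys; apply: le_trans; apply: ge_inf.
  by exists 0 => _ [us _ [vs _ <-]]; exact: orbit_dist_ge0.
by exists xs => //; exists ys.
Qed.

(** An infimum over the empty set of reals is 0 by convention, so this
converse of [cmm_dist_le] needs every point to start an orbit. *)
Lemma cmm_dist_lt n x y e : (forall j, multivalued (phi j)) ->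
  cmm_dist phi p n x y < e ->
  exists xs ys : 'I_n.+1 -> X,
    [/\ Orb_from phi x xs, Orb_from phi y ys & orbit_dist p xs ys < e].
Proof.
move=> phi0 /inf_lt[].
  have [xs xxs] := @Orb_from_nonempty n x phi0.
  have [ys yys] := @Orb_from_nonempty n y phi0.
  by exists (orbit_dist p xs ys), xs => //; exists ys.
by move=> _ [xs xxs [ys yys <-]] lte; exists xs, ys.
Qed.

Lemma cmm_dist_sym n x y : pseudometric p ->
  cmm_dist phi p n x y = cmm_dist phi p n y x.
Proof.
move=> pp; congr inf; apply/seteqP; split=> _ [xs xxs [ys yys <-]];
  by exists ys => //; exists xs => //; exact: orbit_dist_sym.
Qed.

Lemma cmm_dist_diag n x e : pseudometric p ->
  (forall j, multivalued (phi j)) -> 0 <= e -> cmm_dist phi p n x x <= e.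
Proof.
move=> pp phi0 e0; have [xs xxs] := @Orb_from_nonempty n x phi0.
by apply: (cmm_dist_le xxs xxs); rewrite orbit_dist_refl.
Qed.

End OrbitDist.

(** * Uniform covers *)

Section Comparison.
Context (R : realType) (X : topologicalType) (U : set (X -> X -> R)).
Hypotheses (U_uniformity : uniformity U) (U_topology : induces_topology U).

Lemma pball_open p x r : U p -> 0 < r -> open (pball p x r).
Proof. by move=> Up r0; apply: U_topology.1; exists p, x, r. Qed.

Lemma pball_center p x r : U p -> 0 < r -> pball p x r x.
Proof.
move=> Up r0; rewrite /pball/=.
by rewrite (pseudometric_refl (uniformity_pseudometric U_uniformity Up)).
Qed.

Lemma nbhs_pball (x : X) (A : set X) : nbhs x A ->
  exists p r, [/\ U p, 0 < r & pball p x r `<=` A].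
Proof.
move=> /(U_topology.2 x)[_ [[p [y [r [Up r0 ->]]]] pyx] /= BA].
have pp := uniformity_pseudometric U_uniformity Up.
exists p, (r - p y x); split=> //; first by rewrite subr_gt0.
move=> z; rewrite /pball/= ltrBrDl => xz; apply: BA.
exact: le_lt_trans (pseudometric_triangle pp y x z) xz.
Qed.

Lemma pball_cover p e : U p -> 0 < e ->
  @open_cover X (range (fun x => pball p x e)).
Proof.
move=> Up e0; split; first by move=> _ [x _ <-]; exact: pball_open.
apply/seteqP; split=> // x _; exists (pball p x e); first by exists x.
exact: pball_center.
Qed.

Lemma pball_diam p z e x y : U p ->
  pball p z (e / 2) x -> pball p z (e / 2) y -> p x y <= e.
Proof.
move=> Up; rewrite /pball/= => zx zy.
have pp := uniformity_pseudometric U_uniformity Up.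
apply: (le_trans (pseudometric_triangle pp x z y)).
by rewrite [leRHS]splitr lerD// ltW// (pseudometric_sym pp).
Qed.

Lemma orbit_dist_pball p e n (A : 'I_n.+1 -> set X) (xs ys : 'I_n.+1 -> X) :
  U p -> 0 < e ->
  (forall i, [/\ range (fun x => pball p x (e / 2)) (A i),
     A i (xs i) & A i (ys i)]) ->
  orbit_dist p xs ys <= e.
Proof.
move=> Up e0 AP; apply: orbit_dist_le => [|i]; first exact: ltW.
have [[z _ <-] zx zy] := AP i; exact: pball_diam zx zy.
Qed.

(** Lebesgue's number lemma for uniformities. *)
Lemma lebesgue_number (C : set (set X)) : [set: X] !=set0 ->
  compact [set: X] -> open_cover C ->
  exists p e, [/\ U p, 0 < e &
    forall x, exists2 A, C A & forall y, p x y <= e -> A y].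
Proof.
move=> [x0 _] /compact_near_coveringP Xc [Co Cc].
pose D := [set pe : (X -> X -> R) * R | U pe.1 /\ 0 < pe.2].
pose B (pe : (X -> X -> R) * R) := [set qd : (X -> X -> R) * R |
  [/\ D qd, forall x y, pe.1 x y <= qd.1 x y & qd.2 <= pe.2]].
(* The sets B (p, e), of pairs finer than (p, e), generate a filter on pairs;
the property wanted of (p, e) is eventually true along it locally at each
point, hence on all of X by compactness. *)
have F_filter : Filter (filter_from D B).
  apply: filter_from_filter.
    have [p [r [Up r0 _]]] := @nbhs_pball x0 setT filterT.
    by exists (p, r).
  move=> [p d] [q e] [/= Up d0] [/= Uq e0].
  exists (fun x y => Num.max (p x y) (q x y), Num.min d e).
    by split; [exact: uniformity_max|rewrite lt_min d0].
  move=> [s f] [/= Ds pqs]; rewrite le_min => /andP[fd fe].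
  split; split=> // x y /=; move: (pqs x y); rewrite ge_max => /andP[]//.
pose P (qd : (X -> X -> R) * R) x :=
  exists2 A, C A & forall y, qd.1 x y <= qd.2 -> A y.
have [x _|[p e] [/= Up e0] BP] := Xc _ _ P F_filter; last first.
  exists p, e; split=> // x; have := BP (p, e) _ x I; apply.
  by split.
have [A CA Ax] : cover C id x by rewrite Cc.
have [p [r [Up r0 pA]]] := @nbhs_pball x A (open_nbhs_nbhs (conj (Co _ CA) Ax)).
have pp := uniformity_pseudometric U_uniformity Up.
have r2 : 0 < r / 2 by rewrite divr_gt0.
have r4 : 0 < r / 2 / 2 by rewrite divr_gt0.
exists (pball p x (r / 2), B (p, r / 2 / 2)) => /=.
  split; last by exists (p, r / 2 / 2).
  by apply: open_nbhs_nbhs; split; [exact: pball_open|exact: pball_center].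
move=> [y [q d]] [/= xy [[/= Uq d0] pq dr]]; exists A => // z /= qz.
apply: pA; apply: le_lt_trans (pseudometric_triangle pp x y z) _.
rewrite [ltRHS]splitr ltr_leD//; apply: (le_trans (pq _ _)).
apply: (le_trans qz); apply: (le_trans dr).
by rewrite ler_pdivrMr// ler_peMr ?(ltW r2)// ler1n.
Qed.

(** * Comparison of the entropies *)

Section Entropies.
Context (phi : nat -> X -> set X).
Hypotheses (X_nonempty : [set: X] !=set0) (X_compact : compact [set: X]).
Hypothesis (phi_multivalued : forall j, multivalued (phi j)).

Lemma h_L_le_h_CMM_span : (h_L R phi <= h_CMM_span U phi)%E.
Proof.
apply: ge_ereal_sup => _ [C C_cover <-].
have [p [e [Up e0 peC]]] := lebesgue_number X_nonempty X_compact C_cover.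
have e2 : 0 < e / 2 by rewrite divr_gt0.
(* At scale e / 2 the infimum in [cmm_dist] is less than e, so that some pair
of orbits is at distance less than e although it need not be attained. *)
apply: le_trans (ereal_sup_ubound _); last by exists p => //; exists (e / 2).
apply: growth_le => n; apply: le_ereal_inf_tmp => _ [S Sspan <-].
apply: ge_ereal_inf; exists (@counting (set X) R (star phi C n @` S)).
  exists (star phi C n @` S) => //; split; first by move=> _ [x _ <-]; exists x.
  apply/seteqP; split=> // y _; have [x Sx xy] := Sspan y.
  exists (star phi C n x); first by exists x.
  have : cmm_dist phi p n x y < e.
    by rewrite (le_lt_trans xy)// ltr_pdivrMr// ltr_pMr// ltr1n.
  move=> /(cmm_dist_lt phi_multivalued)[xs [ys [xxs [oys ys0] xys]]].
  exists ys => //; split=> //; exists xs => //.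
  have /choice[A AP] : forall i : 'I_n.+1,
      exists A, C A /\ forall z, p (xs i) z <= e -> A z.
    by move=> i; have [A CA pA] := peC (xs i); exists A.
  exists A => i; have [CA pA] := AP i; split=> //; apply: pA.
    rewrite (pseudometric_refl (uniformity_pseudometric U_uniformity Up)).
    exact: ltW.
  by rewrite ltW// (le_lt_trans _ xys)// le_orbit_dist.
by apply: counting_le; exact: card_image_le.
Qed.

Lemma h_CMM_span_le_h_L : (h_CMM_span U phi <= h_L R phi)%E.
Proof.
apply: ge_ereal_sup => _ [p Up [e e0 <-]].
have e2 : 0 < e / 2 by rewrite divr_gt0.
pose C := range (fun x => pball p x (e / 2)).
apply: le_trans (ereal_sup_ubound _); last first.
  by exists C => //; exact: pball_cover.
apply: growth_le => n; apply: le_ereal_inf_tmp => _ [D [DC Dcover] <-].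
have [x0 _] := X_nonempty.
have /choice[g gP] : forall d, exists x, D d -> star phi C n x = d.
  move=> d; have [/DC[x _ <-]|nDd] := pselect (D d); first by exists x.
  by exists x0.
apply: ge_ereal_inf; exists (@counting X R (g @` D)); last first.
  by apply: counting_le; exact: card_image_le.
exists (g @` D) => // y.
have [d Dd dy] : cover D id y by rewrite Dcover.
exists (g d); first by exists d.
have : star phi C n (g d) y by rewrite (gP d Dd).
move=> -[ys [oys [xs xxs [A AP]]] ys0].
apply: (@cmm_dist_le _ _ _ _ _ _ _ xs ys) => //.
exact: (orbit_dist_pball Up e0 AP).
Qed.

Lemma h_CMM_span_le_h_CMM_sep : (h_CMM_span U phi <= h_CMM_sep U phi)%E.
Proof.
apply: ge_ereal_sup => _ [p Up [e e0 <-]].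
apply: le_trans (ereal_sup_ubound _); last by exists p => //; exists e.
apply: growth_le => n.
have pp := uniformity_pseudometric U_uniformity Up.
have [x _|x y|S [_ Ssep Sspan]] :=
  @exists_separated_spanning R X (cmm_dist phi p n) setT e.
- by apply: cmm_dist_diag => //; exact: ltW.
- exact: cmm_dist_sym.
apply: (@le_trans _ _ (@counting X R S)).
  by apply: ereal_inf_lbound; exists S => // y; exact: Sspan.
by apply: ereal_sup_ubound; exists S.
Qed.

Lemma h_CMM_sep_le_h_U : (h_CMM_sep U phi <= h_U R phi)%E.
Proof.
apply: ge_ereal_sup => _ [p Up [e e0 <-]].
have e2 : 0 < e / 2 by rewrite divr_gt0.
pose C := range (fun x => pball p x (e / 2)).
apply: le_trans (ereal_sup_ubound _); last first.
  by exists C => //; exact: pball_cover.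
apply: growth_le => n; apply: ge_ereal_sup => _ [S [_ Ssep] <-].
apply: le_ereal_inf_tmp => _ [D [DC Dcover] <-].
have /choice[f fP] : forall x, exists d, D d /\ d x.
  move=> x; have [d Dd dx] : cover D id x by rewrite Dcover.
  by exists d.
apply: counting_le; apply: (@card_le_trans _ _ _ (f @` S)); last first.
  by apply: subset_card_le => _ [x _ <-]; exact: (fP x).1.
suff: (f @` S #= S)%card by rewrite card_eq_le => /andP[].
apply: inj_card_eq => x y /set_mem Sx /set_mem Sy fxy.
apply: contrapT => /(Ssep _ _ Sx Sy); apply/negP; rewrite -leNgt.
have [Dfx fx] := fP x; have [_] := fP y; rewrite -fxy.
have [A AC fxE] := DC _ Dfx; move: fx; rewrite -fxE.
move=> [xs [oxs Axs] xs0] [ys [oys Ays] ys0].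
apply: (@cmm_dist_le _ _ _ _ _ _ _ xs ys) => //.
apply: (@orbit_dist_pball p e n A) => // i.
by split; [exact: AC|exact: Axs|exact: Ays].
Qed.

Lemma h_U_le_h_KTRT : (h_U R phi <= h_KTRT U phi)%E.
Proof.
apply: ge_ereal_sup => _ [C C_cover <-].
have [p [e [Up e0 peC]]] := lebesgue_number X_nonempty X_compact C_cover.
have pp := uniformity_pseudometric U_uniformity Up.
apply: le_trans (ereal_sup_ubound _); last by exists p => //; exists e.
apply: growth_le => n.
have [xs _|xs ys|S [SO Ssep Sspan]] :=
  @exists_separated_spanning R _ (@orbit_dist R X p n) (@Orb X phi n) e.
- by rewrite orbit_dist_refl// ltW.
- exact: orbit_dist_sym.
have /choice[a aP] : forall x, exists A, C A /\ forall y, p x y <= e -> A y.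
  by move=> x; have [A CA pA] := peC x; exists A.
pose G (xs : 'I_n.+1 -> X) := cell phi (fun i => a (xs i)).
apply: (@le_trans _ _ (@counting _ R S)); last first.
  by apply: ereal_sup_ubound; exists S.
apply: (@le_trans _ _ (@counting (set X) R (G @` S))); last first.
  by apply: counting_le; exact: card_image_le.
apply: ereal_inf_lbound; exists (G @` S) => //; split.
  by move=> _ [xs _ <-]; exists (fun i => a (xs i)) => // i; exact: (aP _).1.
apply/seteqP; split=> // y _.
have [ys [oys ys0]] := @Orb_from_nonempty X phi n y phi_multivalued.
have [xs Sxs xys] := Sspan _ oys.
exists (G xs); first by exists xs.
exists ys => //; split=> // i; apply: (aP _).2.
exact: le_trans (le_orbit_dist _ _ _ i) xys.
Qed.

End Entropies.
End Comparison.

Theorem theorem4p10 (R : realType) (X : topologicalType)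
    (U : set (X -> X -> R)) (phi : nat -> X -> set X)
    (X_nonempty : [set: X] !=set0)
    (X_compact : compact [set: X])
    (X_hausdorff : hausdorff_space X)
    (U_uniformity : uniformity U)
    (U_topology : induces_topology U)
    (phi_multivalued : forall j, multivalued (phi j))
    (phi_lsc : forall j, lsc (phi j)) :
  [/\ h_L R phi = h_CMM_span U phi,
      (h_CMM_span U phi <= h_CMM_sep U phi)%E,
      (h_CMM_sep U phi <= h_U R phi)%E &
      (h_U R phi <= h_KTRT U phi)%E].
Proof.
split.
- apply/le_anti/andP; split; first exact: h_L_le_h_CMM_span.
  exact: h_CMM_span_le_h_L.
- exact: h_CMM_span_le_h_CMM_sep.
- exact: h_CMM_sep_le_h_U.
- exact: h_U_le_h_KTRT.
Qed.
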